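(* Let $R$ be a principal ideal domain, let $0\le \ell\le n$ be integers, and let $E\in M_n(R)$. Then $E$ is an idempotent of rank $\ell$ if and only if $$E=\begin{pmatrix} CA & CB\\ DA & DB\end{pmatrix}$$ for some $A,C\in M_\ell(R)$, some $\ell\times(n-\ell)$ matrix $B$ over $R$ and some $(n-\ell)\times \ell$ matrix $D$ over $R$ such that $AC+BD=I_\ell$.
   Context: The rank of a matrix over an integral domain $R$ is its rank as a matrix over the field of fractions of $R$. $I_\ell$ is the $\ell\times\ell$ identity matrix. Blocks of size $0$ are allowed and are empty. *)

(* Defs.v *)
From HB Require Import structures.
From mathcomp Require Import all_boot all_order all_algebra.

Set Implicit Arguments.
Unset Strict Implicit.
Unset Printing Implicit Defensive.

Import GRing.Theory.
Local Open Scope ring_scope.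

(* [Prop]-valued, so that non-decidable ideals are covered; unlike MathComp's
   [idealr_closed], the unit ideal is not excluded. *)
Definition is_ideal (R : comNzRingType) (I : R -> Prop) : Prop :=
  [/\ I 0,
      forall x y, I x -> I y -> I (x + y)
    & forall a x, I x -> I (a * x)].

Definition is_pid (R : idomainType) : Prop :=
  forall I : R -> Prop, is_ideal I ->
    exists g : R, forall x, I x <-> exists a, x = a * g.

Definition frac_rank (R : idomainType) (m n : nat) (A : 'M[R]_(m, n)) : nat :=
  \rank (map_mx (@tofrac R) A).

(* Main.v *)
Require Import Defs.
From HB Require Import structures.
From mathcomp Require Import all_boot all_order all_algebra.

Set Implicit Arguments.
Unset Strict Implicit.
Unset Printing Implicit Defensive.

Import GRing.Theory.
Local Open Scope ring_scope.

(** Both directions pass through the coordinate-free form: an idempotent of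
    rank l is a product E = P Q with P of size n by l, Q of size l by n and
    Q P = 1; cutting P and Q after their first l rows and columns gives the
    blocks C, D and A, B ([idempotent_factorP], [block_factorP]).

    If Q P = 1, then P Q is idempotent, and it has rank l because P has a left
    inverse and Q a right inverse.  Conversely, over a principal ideal domain
    every matrix of rank r factors through the free module of rank r
    ([rank_factorization]), because its row space is free.  For an idempotent
    E = P Q this factorization gives P (Q P) Q = P Q, and over the field of
    fractions P can be cancelled on the left and Q on the right, so Q P = 1.

    The factorization is obtained by removing one column at a time.  If v is a
    nonzero column of A, the ideal of its entries is generated by some g, so
    v = g p and x v = g for a column p and a row x with x p = 1
    ([primitive_column]).  The projection 1 - p x kills v, hence
    A = p (x A) + (1 - p x) A, where the first term is an outer product and
    the second has a zero column in place of v. *)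

Notation toK := (map_mx (@tofrac _)).

Section RankFactorization.

Variable R : idomainType.

Lemma map_tofrac_inj m n : injective (toK : 'M[R]_(m, n) -> _).
Proof.
move=> A B /matrixP eqAB; apply/matrixP=> i j.
by have := eqAB i j; rewrite !mxE => /eqP; rewrite tofrac_eq => /eqP.
Qed.

Lemma frac_rank_mul m r n (P : 'M[R]_(m, r)) (Q : 'M[R]_(r, n)) :
  row_full (toK P) -> row_free (toK Q) -> frac_rank (P *m Q) = r.
Proof.
move=> fullP freeQ.
by rewrite /frac_rank map_mxM (eqmxMfull _ fullP); apply/eqP.
Qed.

(** The set of all x v with x a row is the ideal generated by the entries of
    v, and each entry is a multiple of its generator g. *)
Lemma primitive_column m (v : 'cV[R]_m) : is_pid R -> v != 0 ->
  exists (g : R) (p : 'cV[R]_m) (x : 'rV[R]_m),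
    [/\ g != 0, v = g *: p & x *m p = 1%:M].
Proof.
move=> hR v_neq0.
pose I y := exists x : 'rV[R]_m, y = (x *m v) 0 0.
have idealI : is_ideal I.
  split.
  - by exists 0; rewrite mul0mx mxE.
  - by move=> _ _ [x ->] [y ->]; exists (x + y); rewrite mulmxDl [RHS]mxE.
  - by move=> a _ [x ->]; exists (a *: x); rewrite -scalemxAl [RHS]mxE.
have [g gP] := hR I idealI.
have dvd_g i : exists a, v i 0 == a * g.
  suff /gP[a vE] : I (v i 0) by exists a; apply/eqP.
  by exists (delta_mx 0 i); rewrite -rowE mxE.
pose p : 'cV[R]_m := \col_i xchoose (dvd_g i).
have vE : v = g *: p.
  apply/colP=> i; rewrite !mxE mulrC.
  exact/eqP/(xchooseP (dvd_g i)).
have g_neq0 : g != 0.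
  by apply: contraNneq v_neq0 => g0; rewrite vE g0 scale0r.
have [x gE] : I g by apply/gP; exists 1; rewrite mul1r.
exists g, p, x; split=> //; apply/matrixP=> i j; rewrite !ord1 [RHS]mxE.
by apply: (mulfI g_neq0); rewrite mulr1 {2}gE vE -scalemxAr [RHS]mxE.
Qed.

(** The two full-rank conditions say that r is the rank of A, in the form in
    which P and Q are cancelled later; it is also the form that goes through
    the induction on the number of columns. *)
Lemma rank_factorization m n (A : 'M[R]_(m, n)) : is_pid R ->
  exists (r : nat) (P : 'M[R]_(m, r)) (Q : 'M[R]_(r, n)),
    [/\ A = P *m Q, row_full (toK P) & row_free (toK Q)].
Proof.
move=> hR; elim: n A => [|n IHn] => [A|].
  exists 0, 0, 0; split; first by apply/matrixP=> i [].
    by rewrite /row_full -leqn0 rank_leq_col.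
  by rewrite /row_free -leqn0 rank_leq_row.
rewrite -add1n => A.
have [v0 | v_neq0] := eqVneq (lsubmx A) 0.
  have [r [P [Q [AE fullP /row_freeP[S QS]]]]] := IHn (rsubmx A).
  exists r, P, (row_mx 0 Q); split=> //.
    by rewrite mul_mx_row mulmx0 -AE -v0 hsubmxK.
  apply/row_freeP; exists (col_mx 0 S).
  by rewrite map_row_mx mul_row_col mulmx0 add0r.
have [g [p [x [g_neq0 vE xp]]]] := primitive_column hR v_neq0.
have [r [P [Q [A1E /row_fullP[L LP] /row_freeP[S QS]]]]] :=
  IHn (rsubmx A - p *m (x *m rsubmx A)).
have xpK : toK x *m toK p = 1%:M by rewrite -map_mxM xp map_mx1.
(* The remainder (1 - p x) A is annihilated by x, and Q can be cancelled. *)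
have xPK : toK x *m toK P = 0.
  rewrite -[LHS]mulmx1 -QS mulmxA -(mulmxA (toK x)) -!map_mxM -A1E.
  by rewrite mulmxBr !mulmxA xp mul1mx subrr map_mx0 mul0mx.
have gK : tofrac g != 0 by rewrite tofrac_eq0.
exists (1 + r), (row_mx p P), (block_mx g%:M (x *m rsubmx A) 0 Q); split.
- rewrite mul_row_block mulmx0 addr0 -A1E addrC subrK mul_mx_scalar -vE.
  by rewrite hsubmxK.
- (* L is corrected along x so that it kills p; this leaves L P = 1 unchanged
     because x P = 0. *)
  apply/row_fullP; exists (col_mx (toK x) (L - L *m toK p *m toK x)).
  rewrite map_row_mx mul_col_row xpK xPK !mulmxBl -!mulmxA xpK xPK LP.
  by rewrite !mulmx0 mulmx1 subrr subr0 -scalar_mx_block.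
- (* A right inverse by block substitution; g has to be inverted, so this
     holds only over the field of fractions. *)
  apply/row_freeP; set w := toK (x *m rsubmx A).
  exists (block_mx (tofrac g)^-1%:M (- ((tofrac g)^-1 *: (w *m S))) 0 S).
  rewrite map_block_mx map_scalar_mx map_mx0 mulmx_block -/w !mulmx0 !mul0mx.
  rewrite !addr0 !add0r QS mulmxN -scalar_mxM mul_scalar_mx scalerA divff //.
  by rewrite scale1r addNr -scalar_mx_block.
Qed.

Lemma idempotent_factorP n l (E : 'M[R]_n) : is_pid R ->
  (E *m E = E /\ frac_rank E = l) <->
  (exists (P : 'M[R]_(n, l)) (Q : 'M[R]_(l, n)),
      Q *m P = 1%:M /\ E = P *m Q).
Proof.
move=> hR; split=> [[EE rankE] | [P [Q [QP ->]]]].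
  have [r [P [Q [EPQ fullP freeQ]]]] := rank_factorization E hR.
  have rl : r = l by rewrite -rankE EPQ frac_rank_mul.
  case: l / rl rankE => _; exists P, Q; split=> //.
  apply: map_tofrac_inj; apply: (row_full_inj fullP); apply: (row_free_inj freeQ).
  by rewrite -!map_mxM mulmx1 !mulmxA -EPQ -mulmxA -EPQ EE.
have QPK : toK Q *m toK P = 1%:M by rewrite -map_mxM QP map_mx1.
split; first by rewrite mulmxA -(mulmxA P) QP mulmx1.
by apply: frac_rank_mul; [apply/row_fullP; exists (toK Q)
                         | apply/row_freeP; exists (toK P)].
Qed.

(** The equation is a parameter so that it can be eliminated; this is not
    possible for l + (n - l) = n itself. *)
Lemma block_factorP l k n (e : (l + k)%N = n) (E : 'M[R]_n) :
  (exists (P : 'M[R]_(n, l)) (Q : 'M[R]_(l, n)),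
      Q *m P = 1%:M /\ E = P *m Q) <->
  (exists (A C : 'M[R]_l) (B : 'M[R]_(l, k)) (D : 'M[R]_(k, l)),
      A *m C + B *m D = 1%:M /\
      E = castmx (e, e)
            (block_mx (C *m A) (C *m B) (D *m A) (D *m B))).
Proof.
case: n / e E => E; split=> [[P [Q [QP ->]]] | [A [C [B [D [ACBD ->]]]]]].
  exists (lsubmx Q), (usubmx P), (rsubmx Q), (dsubmx P).
  by rewrite castmx_id -mul_row_col -mul_col_row hsubmxK vsubmxK.
exists (col_mx C D), (row_mx A B).
by rewrite castmx_id mul_row_col mul_col_row.
Qed.

End RankFactorization.

Theorem theorem3p10 (R : idomainType) (hR : is_pid R) (l n : nat)
    (hln : (l <= n)%N) (E : 'M[R]_n) :
  (E *m E = E /\ frac_rank E = l) <->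
  (exists (A C : 'M[R]_l) (B : 'M[R]_(l, n - l)) (D : 'M[R]_(n - l, l)),
      A *m C + B *m D = 1%:M /\
      E = castmx (subnKC hln, subnKC hln)
            (block_mx (C *m A) (C *m B) (D *m A) (D *m B))).
Proof.
by split=> [/(idempotent_factorP _ _ hR)/(block_factorP (subnKC hln))
           | /block_factorP/(idempotent_factorP _ _ hR)].
Qed.
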